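(* Let $(X,\mathcal F)$ be a measurable space, let $v$ be a capacity on $\mathcal F$, and let $\hat v$ be its totally balanced cover. Then the following two conditions are equivalent: (i) $\lim_n\int^{Cav}_X f_n\,dv=\int^{Cav}_X f\,dv$ for every increasing sequence $\{f_n\}_n\subset\mathcal M$ converging weakly $v$-a.e. to a function $f\in\mathcal M$; (ii) $\hat v$ is null-additive and continuous from below.
   Context: $\mathcal M$ is the collection of all nonnegative $\mathcal F$-measurable functions on $X$. A capacity is a finite set function $v:\mathcal F\to[0,\infty)$ with $v(\emptyset)=0$ and $v(F)\le v(E)$ whenever $F\subseteq E$. The concave integral of $f\in\mathcal M$ with respect to $v$ is $\int^{Cav}_X f\,dv:=\sup\{\sum_{i=1}^N\lambda_i v(F_i): \sum_{i=1}^N\lambda_i \mathbf 1_{F_i}\le f,\ F_i\in\mathcal F,\ \lambda_i\ge 0,\ N\in\mathbb N\}$, where $\mathbf 1_F$ is the characteristic function of $F$. The totally balanced cover of $v$ is the set function $\hat v(F):=\int^{Cav}_X\mathbf 1_F\,dv$, $F\in\mathcal F$. A sequence $\{f_n\}_n$ is increasing if $f_n\le f_{n+1}$ pointwise for all $n$. $\{f_n\}_n$ converges to $f$ weakly $v$-a.e. if $v(\{x\in X: f_n(x)\nrightarrow f(x)\})=0$. A monotone set function $w$ on $\mathcal F$ is null-additive if $w(E\cup F)=w(F)$ for every $E\in\mathcal F$ with $w(E)=0$ and every $F\in\mathcal F$; it is continuous from below if $\lim_n w(F_n)=w(\bigcup_n F_n)$ for every increasing sequence $F_1\subseteq F_2\subseteq\cdots$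 in $\mathcal F$. *)

(* Defs.v *)
From HB Require Import structures.
From mathcomp Require Import all_boot all_order all_algebra.
From mathcomp Require Import all_classical all_reals all_analysis.

Set Implicit Arguments.
Unset Strict Implicit.
Unset Printing Implicit Defensive.

Import Order.TTheory GRing.Theory Num.Theory.
Import numFieldNormedType.Exports.

Local Open Scope classical_set_scope.
Local Open Scope ring_scope.

Section Defs.
Context {R : realType} {d : measure_display} {T : measurableType d}.

(* Set functions on the sigma-algebra are represented by total functions on
   [set T]; every notion below looks at their values on measurable sets only. *)
Record capacity (v : set T -> R) : Prop := Capacity {
  capacity_set0 : v set0 = 0 ;
  capacity_ge0 : forall F, measurable F -> 0 <= v F ;
  capacity_le : forall F E, measurable F -> measurable E ->
    F `<=` E -> v F <= v E }.

Definition nonneg_measurable (f : T -> R) : Prop :=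
  measurable_fun [set: T] f /\ forall x, 0 <= f x.

(* The supremum is taken in the extended reals: it may be +oo even though [v]
   and [f] are finite. *)
Definition concave_integral (v : set T -> R) (f : T -> R) : \bar R :=
  ereal_sup [set y | exists (N : nat) (lam : 'I_N -> R) (F : 'I_N -> set T),
    [/\ forall i, measurable (F i),
        forall i, 0 <= lam i,
        forall x, \sum_(i < N) lam i * \1_(F i) x <= f x &
        y = (\sum_(i < N) lam i * v (F i))%:E]].

Definition totally_balanced_cover (v : set T -> R) (F : set T) : \bar R :=
  concave_integral v \1_F.

Definition weak_ae_cvg (v : set T -> R) (f_ : nat -> T -> R) (f : T -> R) :
    Prop :=
  v [set x | ~ (f_ n x @[n --> \oo] --> f x)] = 0.

Definition null_additive (w : set T -> \bar R) : Prop :=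
  forall E F, measurable E -> measurable F ->
    w E = 0%E -> w (E `|` F) = w F.

Definition continuous_from_below (w : set T -> \bar R) : Prop :=
  forall F : nat -> set T,
    (forall n, measurable (F n)) -> (forall n, F n `<=` F n.+1) ->
    w (F n) @[n --> \oo] --> w (\bigcup_n F n).

End Defs.

(* Main.v *)
Require Import Defs.
From mathcomp Require Import all_boot all_order all_algebra.
From mathcomp Require Import all_classical all_reals all_analysis.
From mathcomp Require Import measurable_realfun.
Import numFieldNormedType.Exports.
Local Open Scope classical_set_scope.
Local Open Scope ring_scope.
Import Order.TTheory GRing.Theory Num.Theory.

(** Write I for the concave integral and w for the totally balanced cover,
    so that w F = I (1_F), v <= w, and both I and w are monotone.

    Suppose monotone convergence holds. Applied to the indicators of an
    increasing sequence of sets it is continuity from below of w. If w E = 0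
    then v (E \ F) = 0, so the constant sequence 1_F converges weakly v-a.e.
    to the indicator of E union F; monotone convergence along it says that
    w (E union F) = w F.

    Conversely, I is positively homogeneous and superadditive, so any
    combination of indicators with coefficients lam_i lying below f satisfies
    sum_i lam_i w (F_i) <= I f: the set function v may be replaced by its cover
    in the definition of I ([sum_totally_balanced_cover_le]). Properties of w
    thus transfer to I.
    - A set N with v N = 0 has w N = 0, and null-additivity lets every F_i be
      replaced by F_i \ N; hence I only depends on the values off N
      ([le_concave_integral_off_null]). As f_n <= f off the exceptional set,
      I f_n <= I f.
    - For the opposite inequality take g = sum_i lam_i 1_(F_i) <= f and
      0 < c < 1. The sets A_n = {c g <= f_n} increase and cover everything
      off N: where g > 0, f_n tends to f > c g, and where g = 0, f_n >= 0.
      Since c sum_i lam_i w (F_i & A_n) <= I f_n, continuity from below gives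
      c sum_i lam_i v (F_i) <= lim I f_n, and c may tend to 1
      ([concave_integral_le_sup_nondecreasing]).

    The values of I and w may be infinite. This is harmless: the sums
    sum_i lam_i v (F_i) to be bounded are real, and the sums involving w have
    nonnegative terms with real coefficients. *)

Section ConcaveIntegral.
Set Implicit Arguments.
Unset Strict Implicit.
Context {R : realType} {d : measure_display} {T : measurableType d}.
Implicit Types (v : set T -> R) (f g : T -> R).

(** * Indicator functions *)

Lemma indic_ge0 (F : set T) x : 0 <= \1_F x :> R.
Proof. by rewrite indicE ler0n. Qed.

Lemma le_indic (E F : set T) x : E `<=` F -> \1_E x <= \1_F x :> R.
Proof.
move=> EF; rewrite !indicE ler_nat.
by case: (boolP (x \in E)) => // /set_mem/EF/mem_set ->.
Qed.

Lemma nonneg_measurable_indic (F : set T) :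
  measurable F -> nonneg_measurable (\1_F : T -> R).
Proof.
by move=> mF; split=> [|x]; [exact: measurable_indic|exact: indic_ge0].
Qed.

Lemma cvg_indic_bigcup (F : nat -> set T) x :
  (forall n, F n `<=` F n.+1) ->
  (\1_(F n) x : R) @[n --> \oo] --> (\1_(\bigcup_n F n) x : R).
Proof.
move=> ndF; have [[k _ Fkx]|nF] := pselect ((\bigcup_n F n) x).
  rewrite [\1_(\bigcup_n F n) x]indicE mem_set; last by exists k.
  apply: cvg_near_cst; exists k => // m /= km.
  rewrite indicE mem_set//; move: Fkx.
  have /nondecreasing_seqP : forall n, (F n <= F n.+1)%O.
    by move=> n; exact/subsetPset/ndF.
  by move=> /(_ _ _ km)/subsetPset; apply.
rewrite [\1_(\bigcup_n F n) x]indicE memNset//.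
apply: cvg_near_cst; apply: nearW => m.
by rewrite indicE memNset// => Fmx; apply: nF; exists m.
Qed.

(** * The concave integral as a superlinear functional *)

Lemma concave_integral_ge_sum v f (N : nat) (lam : 'I_N -> R)
    (F : 'I_N -> set T) :
  (forall i, measurable (F i)) -> (forall i, 0 <= lam i) ->
  (forall x, \sum_(i < N) lam i * \1_(F i) x <= f x) ->
  ((\sum_(i < N) lam i * v (F i))%:E <= concave_integral v f)%E.
Proof.
by move=> mF lam0 Ff; apply: ereal_sup_ubound; exists N, lam, F; split.
Qed.

Lemma ge_concave_integral v f (y : \bar R) :
  (forall (N : nat) (lam : 'I_N -> R) (F : 'I_N -> set T),
    (forall i, measurable (F i)) -> (forall i, 0 <= lam i) ->
    (forall x, \sum_(i < N) lam i * \1_(F i) x <= f x) ->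
    ((\sum_(i < N) lam i * v (F i))%:E <= y)%E) ->
  (concave_integral v f <= y)%E.
Proof.
by move=> h; apply: ge_ereal_sup => _ [N [lam [F [mF lam0 Ff ->]]]]; exact: h.
Qed.

Lemma concave_integral_ge0 v f :
  (forall x, 0 <= f x) -> (0 <= concave_integral v f)%E.
Proof.
move=> f0; have := @concave_integral_ge_sum v f 0 (fun=> 0) (fun=> set0).
by rewrite big_ord0; apply => // x; rewrite big_ord0.
Qed.

Lemma le_concave_integral v f g :
  (forall x, f x <= g x) -> (concave_integral v f <= concave_integral v g)%E.
Proof.
move=> fg; apply: ge_concave_integral => N lam F mF lam0 Ff.
by apply: concave_integral_ge_sum => // x; exact: le_trans (Ff x) (fg x).
Qed.

Lemma concave_integralZ_le v f (c : R) : 0 <= c ->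
  (forall x, 0 <= f x) ->
  (c%:E * concave_integral v f <= concave_integral v (fun x => (c * f x)%R))%E.
Proof.
rewrite le_eqVlt => /predU1P[<- f0|c0 f0].
  by rewrite mul0e; apply: concave_integral_ge0 => x; rewrite mul0r.
rewrite -lee_pdivlMl//; apply: ge_concave_integral => N lam F mF lam0 Ff.
rewrite lee_pdivlMl// -EFinM big_distrr/=.
under eq_bigr do rewrite mulrA.
apply: concave_integral_ge_sum => // [i|x]; first by rewrite mulr_ge0// ltW.
under eq_bigr do rewrite -mulrA.
by rewrite -big_distrr/= ler_pM2l.
Qed.

(** Concatenating a family below f with a family below g gives a family below
    f + g. *)
Lemma concave_integralD_ge v f g :
  (forall x, 0 <= f x) -> (forall x, 0 <= g x) ->
  (concave_integral v f + concave_integral v g <=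
   concave_integral v (fun x => (f x + g x)%R))%E.
Proof.
move=> f0 g0; set z := concave_integral v (fun x => f x + g x).
have fin_le (N : nat) (lam : 'I_N -> R) (F : 'I_N -> set T) :
    (forall i, measurable (F i)) -> (forall i, 0 <= lam i) ->
    (forall x, \sum_(i < N) lam i * \1_(F i) x <= f x) ->
    ((\sum_(i < N) lam i * v (F i))%:E + concave_integral v g <= z)%E.
  move=> mF lam0 Ff; rewrite -leeBrDl//.
  apply: ge_concave_integral => M mu G mG mu0 Gg; rewrite leeBrDl// -EFinD.
  pose nu (i : 'I_(N + M)) :=
    match fintype.split i with inl j => lam j | inr k => mu k end.
  pose H (i : 'I_(N + M)) :=
    match fintype.split i with inl j => F j | inr k => G k end.
  have nuHE (w : set T -> R) : \sum_(i < N + M) nu i * w (H i) =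
      \sum_(i < N) lam i * w (F i) + \sum_(i < M) mu i * w (G i).
    rewrite big_split_ord/=; congr (_ + _); apply: eq_bigr => i _.
      by rewrite /nu /H (unsplitK (inl i)).
    by rewrite /nu /H (unsplitK (inr i)).
  rewrite -nuHE; apply: concave_integral_ge_sum => [i|i|x].
  - by rewrite /H; case: splitP.
  - by rewrite /nu; case: splitP.
  - by rewrite (nuHE (fun A => \1_A x)) lerD.
(* Subtracting I g requires it to be finite; when I g = +oo, the empty family
   below f already forces I (f + g) = +oo. *)
have gge0 : (0 <= concave_integral v g)%E by exact: concave_integral_ge0.
have [gfin|] := boolP (concave_integral v g \is a fin_num).
  rewrite -leeBrDr//; apply: ge_concave_integral => N lam F mF lam0 Ff.
  by rewrite leeBrDr//; exact: fin_le.
rewrite ge0_fin_numE// -leNgt leye_eq => /eqP gy.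
have := fin_le 0%N (fun=> 0) (fun=> set0); rewrite big_ord0 gy add0e leye_eq.
move=> zy; rewrite (eqP (zy _ _ _)) ?leey// => x.
by rewrite big_ord0.
Qed.

(** * The totally balanced cover *)

(** The concave integral does not increase when v is replaced by its cover:
    by definition this is superadditivity and homogeneity of the integral,
    applied to indicators. *)
Lemma sum_totally_balanced_cover_le v f (N : nat) (lam : 'I_N -> R)
    (F : 'I_N -> set T) :
  (forall i, 0 <= lam i) ->
  (forall x, \sum_(i < N) lam i * \1_(F i) x <= f x) ->
  (\sum_(i < N) (lam i)%:E * totally_balanced_cover v (F i) <=
   concave_integral v f)%E.
Proof.
move=> lam0 Ff; apply: le_trans (le_concave_integral v Ff).
elim: (index_enum _) => [|i s IHs].
  rewrite big_nil; apply: concave_integral_ge0 => x.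
  by rewrite big_nil.
rewrite big_cons.
under [X in concave_integral v X]eq_fun do rewrite big_cons.
have term0 j x : 0 <= lam j * \1_(F j) x by rewrite mulr_ge0// indic_ge0.
apply: le_trans (concave_integralD_ge v (term0 i) _); last first.
  by move=> x; apply: sumr_ge0 => j _.
by rewrite leeD//; apply: concave_integralZ_le => // x; exact: indic_ge0.
Qed.

Lemma totally_balanced_cover_ge v (F : set T) : measurable F ->
  ((v F)%:E <= totally_balanced_cover v F)%E.
Proof.
move=> mF.
have := @concave_integral_ge_sum v \1_F 1 (fun=> 1) (fun=> F).
by rewrite big_ord1 mul1r; apply => // x; rewrite big_ord1 mul1r.
Qed.

Lemma le_totally_balanced_cover v (E F : set T) : E `<=` F ->
  (totally_balanced_cover v E <= totally_balanced_cover v F)%E.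
Proof.
by move=> EF; apply: le_concave_integral => x; exact: le_indic.
Qed.

Lemma totally_balanced_cover_ge0 v (F : set T) :
  (0 <= totally_balanced_cover v F)%E.
Proof. by apply: concave_integral_ge0 => x; exact: indic_ge0. Qed.

(** A set occurring with a nonzero coefficient in a combination below 1_N lies
    inside N, hence is itself v-null. *)
Lemma totally_balanced_cover_null v (N : set T) : capacity v ->
  measurable N -> v N = 0 -> totally_balanced_cover v N = 0%E.
Proof.
move=> hv mN vN0; apply/eqP; rewrite eq_le totally_balanced_cover_ge0 andbT.
apply: ge_concave_integral => n lam F mF lam0 FN.
rewrite lee_fin; apply: sumr_le0 => i _.
have [->|lami] := eqVneq (lam i) 0; first by rewrite mul0r.
have FiN : F i `<=` N.
  move=> x Fix; apply: contrapT => Nx; have := FN x.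
  rewrite [\1_N x]indicE memNset//= leNgt; apply/negP; rewrite negbK.
  rewrite (bigD1 i)//= indicE mem_set//= mulr1 ltr_wpDr//.
    by apply: sumr_ge0 => j _; rewrite mulr_ge0// indic_ge0.
  by rewrite lt_neqAle eq_sym lami lam0.
by rewrite mulr_ge0_le0// -vN0; case: hv => _ _; apply.
Qed.

Lemma le_totally_balanced_cover_off_null v (E F N : set T) : capacity v ->
  null_additive (totally_balanced_cover v) ->
  measurable N -> v N = 0 -> measurable F -> E `<=` N `|` F ->
  (totally_balanced_cover v E <= totally_balanced_cover v F)%E.
Proof.
move=> hv na mN vN0 mF ENF; rewrite -(na N F)//.
  exact: le_totally_balanced_cover.
exact: totally_balanced_cover_null.
Qed.

(** * Null sets and monotone convergence *)

(** Since v F <= w F <= w (F \ N), removing N from the sets of a combination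
    below f costs nothing once v is replaced by the cover w, and it turns the
    combination into one below g. *)
Lemma le_concave_integral_off_null v f g (N : set T) : capacity v ->
  null_additive (totally_balanced_cover v) ->
  measurable N -> v N = 0 -> (forall x, 0 <= g x) ->
  (forall x, ~ N x -> f x <= g x) ->
  (concave_integral v f <= concave_integral v g)%E.
Proof.
move=> hv na mN vN0 g0 fg; apply: ge_concave_integral => n lam F mF lam0 Ff.
apply: (@le_trans _ _
  (\sum_(i < n) (lam i)%:E * totally_balanced_cover v (F i `\` N))%E).
  rewrite -sumEFin; apply: lee_sum => i _; rewrite EFinM lee_wpmul2l ?lee_fin//.
  apply: le_trans (totally_balanced_cover_ge v (mF i)) _.
  apply: (le_totally_balanced_cover_off_null hv na mN vN0).
    exact: measurableD.
  by move=> x Fx; have [Nx|Nx] := pselect (N x); [left|right].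
apply: sum_totally_balanced_cover_le => // x.
have [Nx|Nx] := pselect (N x).
  rewrite big1// => i _; rewrite indicE memNset ?mulr0//=.
  by case.
apply: le_trans (fg x Nx); apply: le_trans (Ff x).
apply: ler_sum => i _; rewrite ler_wpM2l//.
by apply: le_indic; exact: subDsetl.
Qed.

(** By monotonicity the sequence converges in the extended reals to its upper
    limit, so convergence to f is an equality between two measurable
    functions. *)
Lemma measurable_nondecreasing_not_cvg (f_ : nat -> T -> R) f :
  (forall n, measurable_fun [set: T] (f_ n)) -> measurable_fun [set: T] f ->
  (forall n x, f_ n x <= f_ n.+1 x) ->
  measurable [set x | ~ (f_ n x @[n --> \oo] --> f x)].
Proof.
move=> mf_ mf nd.
rewrite (_ : [set x | _] =
  ~` [set x | limn_esup (fun n => (f_ n x)%:E) = (f x)%:E]).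
  apply: measurableC; rewrite -[X in measurable X]setTI.
  apply: measurable_eqe => //; last exact/measurable_EFinP.
  by apply: measurable_fun_limn_esup => n; exact/measurable_EFinP.
congr (~` _); apply/seteqP; split => x /=.
  move=> fx; have fxE : (f_ n x)%:E @[n --> \oo] --> (f x)%:E.
    by apply: cvg_EFin => //; exact: nearW.
  by rewrite is_cvg_limn_esupE; [exact: cvg_lim|exact: cvgP fxE].
have cvgf : cvgn (fun n => (f_ n x)%:E).
  apply: ereal_nondecreasing_is_cvgn; apply/nondecreasing_seqP => n.
  by rewrite lee_fin.
rewrite is_cvg_limn_esupE// => limE.
have : (f_ n x)%:E @[n --> \oo] --> (f x)%:E by rewrite -limE.
by move=> /fine_cvg.
Qed.

(** The half of monotone convergence that uses both properties of the cover:
    continuity from below along the sets F_i & A_k, and null-additivity because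
    these only exhaust F_i up to the null set N. *)
Lemma concave_integral_le_sup_nondecreasing v (f_ : nat -> T -> R) f (N : set T)
    (l : \bar R) : capacity v ->
  null_additive (totally_balanced_cover v) ->
  continuous_from_below (totally_balanced_cover v) ->
  measurable N -> v N = 0 ->
  (forall n, nonneg_measurable (f_ n)) ->
  (forall n x, f_ n x <= f_ n.+1 x) ->
  (forall x, ~ N x -> f_ n x @[n --> \oo] --> f x) ->
  (forall n, (concave_integral v (f_ n) <= l)%E) ->
  (concave_integral v f <= l)%E.
Proof.
move=> hv na cb mN vN0 mf_ nd cvf ubl.
apply: ge_concave_integral => n lam F mF lam0 Ff.
have S0 : (0 <= (\sum_(i < n) lam i * v (F i))%:E)%E.
  rewrite lee_fin; apply: sumr_ge0 => i _; rewrite mulr_ge0//.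
  by case: hv => _ v0 _; exact: v0.
(* The factor c < 1 makes c g < f strict where g > 0, so that f_k eventually
   passes c g even where g = f. *)
apply/lee_mul01Pr => // c /andP[c0 c1].
pose g x := \sum_(i < n) lam i * \1_(F i) x.
have g0 x : 0 <= g x.
  by apply: sumr_ge0 => i _; rewrite mulr_ge0// indic_ge0.
pose A k := [set x | c * g x <= f_ k x].
have mg : measurable_fun [set: T] g.
  by apply: measurable_sum => i; exact: measurable_funM.
have mA k : measurable (A k).
  rewrite -[A k]setTI; apply: measurable_fun_le => //.
    exact: measurable_funM.
  by case: (mf_ k).
have ndA k : A k `<=` A k.+1 by move=> x /le_trans; apply; exact: nd.
have NA x : ~ N x -> (\bigcup_k A k) x.
  move=> Nx; have fx := cvf x Nx.
  have [gx0|gx0] := eqVneq (g x) 0.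
    by exists 0%N => //; rewrite /A/= gx0 mulr0; case: (mf_ 0%N).
  have cgf : c * g x < f x.
    apply: (@lt_le_trans _ _ (g x)); last exact: Ff.
    by rewrite gtr_pMl// lt_neqAle eq_sym gx0 g0.
  have [k _ hk] := cvgr_gt (f x) fx _ cgf.
  by exists k => //; exact: ltW (hk k (leqnn k)).
have coverE i : ((v (F i))%:E <=
    totally_balanced_cover v (\bigcup_k (F i `&` A k)))%E.
  apply: le_trans (totally_balanced_cover_ge v (mF i)) _.
  apply: (le_totally_balanced_cover_off_null hv na mN vN0).
    by apply: bigcup_measurable => k _; exact: measurableI.
  move=> x Fx; have [Nx|Nx] := pselect (N x); [by left|right].
  by have [k _ Akx] := NA x Nx; exists k.
have cvg_cover : (\sum_(i < n) (c * lam i)%:E *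
      totally_balanced_cover v (F i `&` A k))%E @[k --> \oo] -->
    (\sum_(i < n) (c * lam i)%:E *
      totally_balanced_cover v (\bigcup_k (F i `&` A k)))%E.
  apply: cvg_nnesum => i _.
    apply: nearW => k; rewrite mule_ge0// ?totally_balanced_cover_ge0//.
    by rewrite lee_fin mulr_ge0// ltW.
  apply: cvgeZl => //; apply: cb => k; first exact: measurableI.
  by apply: setIS; exact: ndA.
apply: (@le_trans _ _ (\sum_(i < n) (c * lam i)%:E *
      totally_balanced_cover v (\bigcup_k (F i `&` A k)))%E).
  rewrite -EFinM big_distrr/= -sumEFin; apply: lee_sum => i _.
  by rewrite mulrA EFinM lee_wpmul2l// lee_fin mulr_ge0// ltW.
apply: cvge_le cvg_cover; apply: nearW => k; apply: le_trans (ubl k).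
apply: sum_totally_balanced_cover_le => [i|x].
  by rewrite mulr_ge0// ltW.
have [Ax|Ax] := pselect (A k x).
  apply: le_trans Ax; rewrite /g big_distrr/=; apply: ler_sum => i _.
  rewrite -mulrA ler_pM2l// ler_wpM2l//.
  by apply: le_indic; exact: subIsetl.
(* Off A_k every term vanishes, and f_k is nonnegative. *)
rewrite big1; first by case: (mf_ k).
by move=> i _; rewrite indicE memNset ?mulr0// => -[].
Qed.

Lemma monotone_convergence_of_cover v (f_ : nat -> T -> R) f : capacity v ->
  null_additive (totally_balanced_cover v) ->
  continuous_from_below (totally_balanced_cover v) ->
  (forall n, nonneg_measurable (f_ n)) -> nonneg_measurable f ->
  (forall n x, f_ n x <= f_ n.+1 x) -> weak_ae_cvg v f_ f ->
  concave_integral v (f_ n) @[n --> \oo] --> concave_integral v f.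
Proof.
move=> hv na cb mf_ [mf f0] nd; rewrite /weak_ae_cvg.
set N := [set x | _] => vN0.
have mN : measurable N.
  by apply: measurable_nondecreasing_not_cvg => // n; case: (mf_ n).
have cvf x : ~ N x -> f_ n x @[n --> \oo] --> f x by exact: contrapT.
have cvI : concave_integral v (f_ n) @[n --> \oo] -->
    ereal_sup (range (fun n => concave_integral v (f_ n))).
  apply: ereal_nondecreasing_cvgn; apply/nondecreasing_seqP => n.
  by apply: le_concave_integral => x; exact: nd.
suff -> : concave_integral v f =
    ereal_sup (range (fun n => concave_integral v (f_ n))) by [].
apply/eqP; rewrite eq_le; apply/andP; split.
  apply: (concave_integral_le_sup_nondecreasing hv na cb mN vN0 mf_ nd cvf).
  by move=> n; apply: ereal_sup_ubound; exists n.
apply: ge_ereal_sup => _ [n _ <-].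
apply: (le_concave_integral_off_null hv na mN vN0 f0) => x Nx.
have fx := cvf x Nx; rewrite -(cvg_lim _ fx)//.
apply: (nondecreasing_cvgn_le (u_ := f_ ^~ x)); last exact: cvgP fx.
by apply/nondecreasing_seqP => m; exact: nd.
Qed.

End ConcaveIntegral.

Theorem theorem5 (R : realType) (d : measure_display) (T : measurableType d)
    (v : set T -> R) (hv : capacity v) :
  (forall (f_ : nat -> T -> R) (f : T -> R),
     (forall n, nonneg_measurable (f_ n)) ->
     nonneg_measurable f ->
     (forall n x, f_ n x <= f_ n.+1 x) ->
     weak_ae_cvg v f_ f ->
     concave_integral v (f_ n) @[n --> \oo] --> concave_integral v f)
  <->
  (null_additive (totally_balanced_cover v) /\
   continuous_from_below (totally_balanced_cover v)).
Proof.
split=> [mct|[na cb]]; last first.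
  by move=> f_ f mf_ mf nd; exact: monotone_convergence_of_cover.
split.
- move=> E F mE mF vE0.
  have vEF0 : v (E `\` F) = 0.
    have mEF := measurableD mE mF.
    case: hv => _ v0 vle; apply/eqP; rewrite eq_le v0// andbT.
    apply: le_trans (vle _ _ mEF mE _) _; first exact: subDsetl.
    by rewrite -lee_fin (le_trans (totally_balanced_cover_ge v mE))// vE0.
  suff cvgF : concave_integral v \1_F @[n --> \oo] -->
      concave_integral v \1_(E `|` F).
    by apply: (cvg_unique _ cvgF) => //; exact: cvg_cst.
  apply: (mct (fun=> \1_F)) => [n||//|].
  + exact: nonneg_measurable_indic.
  + by apply: nonneg_measurable_indic; exact: measurableU.
  + rewrite /weak_ae_cvg (_ : [set x | _] = E `\` F)//.
    apply/seteqP; split => x /=.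
    (* The two indicators differ exactly on E \ F. *)
    * move=> ncv; apply: contrapT => EF; apply: ncv.
      rewrite (_ : \1_(E `|` F) x = \1_F x :> R); first exact: cvg_cst.
      rewrite !indicE; congr (nat_of_bool _)%:R; apply/idP/idP => /set_mem.
        case=> [Ex|Fx]; last exact: mem_set.
        by apply/mem_set; apply: contrapT => nFx; apply: EF.
      by move=> Fx; apply/mem_set; right.
    * move=> [Ex nFx]; rewrite !indicE (memNset nFx) mem_set; last by left.
      move=> /cvg_lim => /(_ (@Rhausdorff R)); rewrite lim_cst//.
      by move=> /eqP; rewrite eq_sym oner_eq0.
- move=> F mF ndF; apply: mct => [n||n x|].
  + exact: nonneg_measurable_indic.
  + by apply: nonneg_measurable_indic; exact: bigcup_measurable.
  + by apply: le_indic; exact: ndF.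
  + rewrite /weak_ae_cvg (_ : [set x | _] = set0); first by case: hv.
    rewrite -subset0 => x /=; apply. exact: cvg_indic_bigcup.
Qed.
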